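(* For every $\lambda > 0$, there exists $C = C(\lambda) > 0$ such that the following holds. Let $\mu$ be the multiplicative function on the positive integers defined by $$\mu(p^i) = 1 + \frac{\lambda}{p}$$ for all primes $p$ and integers $i \ge 1$. For every $M > 0$ and $\varepsilon > 0$, there exists a finite collection of arithmetic progressions $A_1, \dots, A_k$ with distinct square-free moduli $d_1,\dots,d_k \ge M$, such that $$\sum_{i=1}^k \frac{\mu(d_i)}{d_i} \le C,$$ and the density of the uncovered set $R = \mathbb{Z} \setminus \bigcup_{i=1}^k A_i$ is at most $\varepsilon$.
   Context: An arithmetic progression with modulus $d$ is a set of the form $a + d\mathbb{Z}$ with $a \in \mathbb{Z}$, $d \in \mathbb{N}$. The density of the (periodic) set $R$ is the proportion of residue classes modulo $\mathrm{lcm}(d_1,\dots,d_k)$ that it contains. ''Multiplicative'' means $\mu(1)=1$ and $\mu(mn)=\mu(m)\mu(n)$ whenever $\gcd(m,n)=1$. *)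

(* Defs.v *)
From HB Require Import structures.
From mathcomp Require Import all_boot all_order all_algebra.
From mathcomp Require Import all_classical all_reals.

Set Implicit Arguments.
Unset Strict Implicit.
Unset Printing Implicit Defensive.

Import Order.TTheory GRing.Theory Num.Theory.

Local Open Scope classical_set_scope.
Local Open Scope ring_scope.

(* The value at 0 is irrelevant: mu is a function on the positive integers. *)
Definition multiplicative_fun (R : realType) (mu : nat -> R) : Prop :=
  mu 1%N = 1 /\
  forall m n : nat, (0 < m)%N -> (0 < n)%N -> coprime m n ->
    mu (m * n)%N = mu m * mu n.

(* 0 is not square-free for this definition. *)
Definition squarefree (n : nat) : Prop :=
  forall m : nat, (m ^ 2 %| n)%N -> m = 1%N.

Definition arith_prog (a : int) (d : nat) : set int :=
  [set x | exists z : int, x = a + d%:Z * z].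

Definition uncovered (k : nat) (a : 'I_k -> int) (d : 'I_k -> nat) : set int :=
  ~` (\bigcup_(i in [set: 'I_k]) arith_prog (a i) (d i)).

Definition lcm_moduli (k : nat) (d : 'I_k -> nat) : nat :=
  \big[lcmn/1%N]_(i < k) d i.

(* Proportion of the residue classes modulo N contained in S; this is the
   density of S when S is a union of such classes and 0 < N. *)
Definition density (R : realType) (N : nat) (S : set int) : R :=
  #|[set r : 'I_N | `[< arith_prog (r : nat)%:Z N `<=` S >]]%SET|%:R / N%:R.

Lemma multiplicative_fun_exists (R : realType) (lambda : R) :
  exists mu : nat -> R, multiplicative_fun mu /\
    forall p i : nat, prime p -> (1 <= i)%N -> mu (p ^ i)%N = 1 + lambda / p%:R.
Proof.
exists (fun n => \prod_(p <- primes n) (1 + lambda / p%:R)); split; last first.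
  by move=> p i pp i1; rewrite primesX // primes_prime // big_seq1.
split=> [|m n m0 n0 cmn]; first by rewrite big_nil.
rewrite -big_cat; apply: perm_big; apply: uniq_perm.
- exact: primes_uniq.
- by rewrite cat_uniq !primes_uniq andbT /= -coprime_has_primes.
- by move=> p; rewrite mem_cat primesM.
Qed.

(* Main.v *)
Require Import Defs.
From mathcomp Require Import all_boot all_order all_algebra.
From mathcomp Require Import all_classical all_reals.
From mathcomp Require Import sequences exp.
From mathcomp Require Import zify ring lra.

Import Order.TTheory GRing.Theory Num.Theory.
Local Open Scope ring_scope.

(* To deal with an uncovered class b mod q, take a block of new large primes
   with product Q, chosen so that S = \prod_(p | Q) (1 + 1/p) lies in [K, 2K].
   Inside the class, use one progression of modulus q d for every d | Q, d > 1,
   choosing its residue greedily. The part left over has proportion at most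
   \prod_(1 < d | Q) (1 - 1/d) <= exp(1 - S), whereas mu(Q) <= S^L with L >= lambda
   and the block costs at most S^2 mu(q)/q. So for K large the sum of mu(q)/q
   over the remaining classes is halved at a cost proportional to it, and
   iterating gives a convergent geometric series of costs. Using different
   primes for different classes ensures that mu(q) grows only by the factor
   mu(Q) <= (2K)^L at each step, rather than with the number of classes. *)

(** * Finite products of 1 + 1/p over large primes *)

Lemma harmonic_unbounded (R : realType) (K : R) :
  exists n : nat, K <= \sum_(1 <= m < n.+1) m%:R^-1.
Proof.
have H (k : nat) : k%:R / 2 <= \sum_(1 <= m < (2 ^ k).+1) (m%:R^-1 : R).
  elim: k => [|k IH].
    by rewrite mul0r; apply: sumr_ge0 => i _; rewrite invr_ge0.
  have k0 : (0 < 2 ^ k)%N by rewrite expn_gt0.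
  (* The dyadic block from 2^k + 1 to 2^(k+1) has 2^k terms, each at least 1/2^(k+1), so it adds at
     least 1/2. *)
  rewrite (@big_cat_nat _ _ _ (2 ^ k).+1) //=; last by rewrite ltnS leq_exp2l.
  rewrite -natr1 mulrDl lerD // mul1r.
  apply: (@le_trans _ _ (\sum_((2 ^ k).+1 <= i < (2 ^ k.+1).+1) ((2 ^ k.+1)%:R^-1 : R))).
    rewrite sumr_const_nat expnS mul2n -addnn subSS addnK -[leRHS]mulr_natl.
    have N0 : 0 < (2 ^ k)%:R :> R by rewrite ltr0n.
    have -> : (2 ^ k)%:R * (2 ^ k + 2 ^ k)%:R^-1 = 2^-1 :> R by rewrite natrD; field; lra.
    by [].
  rewrite [leLHS]big_nat [leRHS]big_nat; apply: ler_sum => i /andP[i1 i2].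
  rewrite lef_pV2 ?posrE ?ltr0n ?ler_nat; lia.
have [k Hk] : exists k : nat, 2 * K <= k%:R.
  exists (Num.bound `|2 * K|).
  exact/ltW/(le_lt_trans (ler_norm _))/archi_boundP/normr_ge0.
exists (2 ^ k)%N; apply: le_trans (H k); lra.
Qed.

(** Half of Euler's product formula, by sieving: multiplying the sum by 1 - 1/p brings it below the
    corresponding sum for the list without its head [p]. *)
Lemma smooth_sum_le (R : realType) (ps : seq nat) (n : nat) :
  all prime ps ->
  \sum_(1 <= m < n.+1 | all (mem ps) (primes m)) (m%:R^-1 : R)
    <= \prod_(p <- ps) (1 - p%:R^-1)^-1.
Proof.
elim: ps => [_|p ps IH /= /andP[pp aps]].
  rewrite big_nil.
  case: n => [|n]; first by rewrite big_geq.
  rewrite big_ltn_cond //= invr1 big1_seq ?addr0 // => i /andP[] /=.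
  rewrite mem_index_iota => Hp Hi.
  case E : (primes i) Hp => [|q s] //= _.
  by move: E => /eqP; rewrite primes_eq0; lia.
have p0 := prime_gt0 pp.
have p1 : 1 < p%:R :> R by rewrite ltr1n prime_gt1.
have c0 : 0 < 1 - p%:R^-1 :> R by rewrite subr_gt0 invf_lt1 //; lra.
rewrite big_cons mulrC ler_pdivlMr //.
apply: le_trans (IH aps); rewrite mulrBr mulr1 lerBlDr.
rewrite [leLHS](bigID (fun m => p %| m)%N) /= addrC lerD //.
  rewrite [leRHS]big_mkcond [leLHS]big_mkcond; apply: ler_sum => m _.
  case: ifP => [/andP[Hm pm]|_]; last by case: ifP => // _; rewrite invr_ge0.
  rewrite ifT //; apply/allP => q qm; have := allP Hm q qm; rewrite !inE.
  case: eqP => // qp; move: qm; rewrite qp mem_primes (negbTE pm) !andbF //.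
(* The multiples p k of p contribute at most p^-1 times the whole sum. *)
rewrite mulr_suml [leRHS]big_mkcond /=.
(* The substitution [m = p * k] goes through a double sum: a multiple [m] of [p] comes from one [k],
   and each [k] gives at most one [m] in range. *)
apply: (@le_trans _ _ (\sum_(1 <= m < n.+1) \sum_(1 <= k < n.+1)
   if (m == p * k)%N then
     if all (mem (p :: ps)) (primes k) then k%:R^-1 / p%:R else 0 else 0 : R)).
  rewrite [leLHS]big_mkcond big_nat [leRHS]big_nat; apply: ler_sum => m /andP[m0 mn].
  have F0 k : 0 <= (if (m == p * k)%N then
     if all (mem (p :: ps)) (primes k) then k%:R^-1 / p%:R else 0 else 0 : R).
    by do 2! case: ifP => // _; rewrite mulr_ge0 ?invr_ge0.
  case: ifP => [/andP[Hm /dvdnP[k mk]]|_]; last exact: sumr_ge0.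
  have k0 : (0 < k)%N by rewrite mk in m0; lia.
  have kn : (k <= m)%N by rewrite mk; apply: leq_pmulr.
  have kP : all (mem (p :: ps)) (primes k).
    by apply/allP => q qk; apply: (allP Hm); rewrite mk primesM // qk.
  rewrite (bigD1_seq k) ?iota_uniq ?mem_index_iota //=; last lia.
  rewrite mulnC -mk eqxx ifT // -invfM -natrM -mk lerDl.
  exact: sumr_ge0.
rewrite exchange_big /=; apply: ler_sum => k _.
have [kn|kn] := boolP ((p * k)%N \in index_iota 1 n.+1).
  rewrite (bigD1_seq (p * k)%N) ?iota_uniq //= eqxx big1 ?addr0 //.
  by move=> m /negbTE ->.
rewrite big1_seq; first by case: ifP => // _; rewrite mulr_ge0 ?invr_ge0.
move=> m /=; case: eqP => // ->; rewrite (negbTE kn) //.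
Qed.

(** Euler's argument: since 1/(1 - 1/p) <= (1 + 1/p)^2, the square of the full product dominates a
    harmonic sum, and discarding the primes up to [B] costs only the fixed factor [C]. *)
Lemma prime_prod_unbounded (R : realType) (B : nat) (K : R) :
  exists ps : seq nat, [/\ uniq ps, all prime ps, all (fun p => B < p)%N ps
    & K <= \prod_(p <- ps) (1 + p%:R^-1)].
Proof.
pose C : R := \prod_(p <- iota 0 B.+1 | prime p) (1 + p%:R^-1).
have f0 (p : nat) : 0 < 1 + p%:R^-1 :> R by rewrite ltr_wpDr ?invr_ge0.
have C0 : 0 < C by apply: prodr_gt0 => p _.
pose K' : R := Num.max 0 (K * C).
have [n Hn] := harmonic_unbounded _ (K' ^+ 2).
(* Reaching [n] captures all prime factors in the harmonic sum; reaching [B] makes the discarded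
   factor exactly [C]. *)
pose qs := [seq p <- index_iota 0 (maxn n B).+1 | prime p].
exists [seq p <- qs | (B < p)%N]; split.
- by rewrite !filter_uniq ?iota_uniq.
- by apply/allP => p; rewrite !mem_filter => /andP[_ /andP[]].
- exact: filter_all.
have qsC : C * \prod_(p <- [seq p <- qs | (B < p)%N]) (1 + p%:R^-1)
    = \prod_(p <- qs) (1 + p%:R^-1).
  rewrite [RHS](bigID (fun p => B < p)%N) /= mulrC big_filter; congr (_ * _).
  rewrite -big_filter /C -[LHS]big_filter; congr bigop.
  rewrite -!filter_predI.
  rewrite (_ : (maxn n B).+1 = B.+1 + (maxn n B - B))%N; last lia.
  rewrite /index_iota subn0 iotaD filter_cat [X in _ ++ X](_ : _ = [::]) ?cats0.
    apply: eq_in_filter => p; rewrite mem_iota /= => ?.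
    by rewrite -leqNgt (_ : p <= B)%N //; lia.
  apply/eqP; rewrite -[_ == _]negbK -has_filter; apply/negP => /hasP[p].
  rewrite mem_iota /= => ? /andP[]; lia.
suff : K' <= \prod_(p <- qs) (1 + p%:R^-1).
  rewrite -qsC mulrC => H; rewrite -(ler_pM2r C0); apply: le_trans H.
  by rewrite le_max lexx orbT.
rewrite -(@ler_pXn2r _ 2) ?nnegrE ?le_max ?lexx //; last first.
  by apply: prodr_ge0 => p _; apply: ltW.
apply: (le_trans Hn).
have aq : all prime qs by apply: filter_all.
have := smooth_sum_le R _ n aq.
rewrite big_mkcond big_nat (eq_bigr (fun m => m%:R^-1)) => [|m /andP[m0 mn]]; last first.
  rewrite ifT //; apply/allP => q qm; rewrite inE mem_filter mem_index_iota.
  move: qm; rewrite mem_primes => /and3P[-> _ /dvdn_leq]; lia.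
rewrite -big_nat => /le_trans; apply.
rewrite -prodrXl; rewrite [leLHS]big_seq [leRHS]big_seq; apply: ler_prod => p.
rewrite mem_filter => /andP[pp _].
have p2 : 2 <= p%:R :> R by rewrite ler_nat prime_gt1.
have x0 : 0 < p%:R^-1 :> R by rewrite invr_gt0; lra.
have x1 : p%:R^-1 <= 2^-1 :> R by rewrite lef_pV2 ?posrE //; lra.
rewrite invr_ge0 subr_ge0; apply/andP; split; first lra.
move: x0 x1; set x := p%:R^-1 => x0 x1.
(* What remains is 1 <= (1 + x)^2 (1 - x), which follows from x + x^2 <= 1 for 0 < x <= 1/2. *)
rewrite -[leLHS]mul1r ler_pdivrMr; nra.
Qed.

(** Primes are dropped from the front while the remaining product is still at least [K]. Each factor
    1 + 1/p is at most 2, so the overshoot is at most a factor 2. *)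
Lemma prime_prod_window (R : realType) (B : nat) (K : R) : 1 <= K ->
  exists ps : seq nat, [/\ uniq ps, all prime ps, all (fun p => B < p)%N ps,
    K <= \prod_(p <- ps) (1 + p%:R^-1) & \prod_(p <- ps) (1 + p%:R^-1) <= 2 * K].
Proof.
move=> K1; have [ps [ups pps Bps Kps]] := prime_prod_unbounded R B K.
elim: ps ups pps Bps Kps => [|p ps IH] /=.
  by move=> _ _ _ Kps; exists [::]; split=> //; move: Kps; rewrite big_nil; lra.
move=> /andP[pN ups] /andP[pp pps] /andP[Bp Bps] Kps.
have [Kle|Klt] := leP K (\prod_(q <- ps) (1 + q%:R^-1)); first exact: IH.
exists (p :: ps); split; rewrite /= ?pN ?ups ?pp ?pps ?Bp ?Bps //.
rewrite big_cons.
have p1 : p%:R^-1 <= 1 :> R by rewrite invf_le1 ?ltr0n ?ler1n ?prime_gt0.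
have p0 : 0 <= p%:R^-1 :> R by rewrite invr_ge0.
apply: ler_pM; [lra | | lra | exact: ltW].
by apply: prodr_ge0 => q _; rewrite addr_ge0 ?invr_ge0.
Qed.

(** This fixes the size of the blocks: exp(1 - K) will bound the proportion a block leaves over, and
    (2K)^L the value of mu(Q). *)
Lemma expR_beats_power (R : realType) (L : nat) :
  exists K : R, 1 <= K /\ expR (1 - K) * (2 * K) ^+ L <= 2^-1.
Proof.
have F0 : 1 <= L.+1`!%:R :> R by rewrite ler1n fact_gt0.
have P0 : 1 <= 4 ^+ L :> R by apply: exprn_ege1; lra.
(* Chosen so that the term x^(L+1)/(L+1)! of the exponential series equals 2 (4x)^L, while K = 1 + x
   gives 2K <= 4x. *)
pose x : R := 2 * 4 ^+ L * L.+1`!%:R.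
have x1 : 1 <= x by rewrite /x; nra.
exists (1 + x); split; first lra.
have -> : 1 - (1 + x) = - x by ring.
rewrite expRN mulrC ler_pdivrMr ?expR_gt0 // ler_pdivlMl; last lra.
have x0 : 0 <= x by lra.
apply: le_trans (expR_ge1Dxn L x0).
have step : x ^+ L.+1 / L.+1`!%:R = 2 * (4 * x) ^+ L.
  by rewrite exprS -mulrAC [x / _](mulfK _) ?exprMn ?mulrA //; lra.
rewrite step ler_wpDl // ler_pM2l // lerXn2r ?nnegrE; lra.
Qed.

(** * Square-free numbers and sums of multiplicative functions over divisors *)

Lemma squarefree_gt0 (n : nat) : squarefree n -> (0 < n)%N.
Proof. by case: n => // /(_ 2); rewrite dvdn0 => /(_ isT). Qed.

Lemma squarefree_dvd (m n : nat) : (m %| n)%N -> squarefree n -> squarefree m.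
Proof. by move=> mn sn k km; apply/sn/(dvdn_trans km). Qed.

Lemma squarefree1 : squarefree 1.
Proof. by move=> m; rewrite dvdn1 -mulnn muln_eq1 andbb => /eqP. Qed.

Lemma squarefreeM (m n : nat) :
  coprime m n -> squarefree m -> squarefree n -> squarefree (m * n).
Proof.
move=> cmn sm sn k kmn.
have mn0 : (0 < m * n)%N by rewrite muln_gt0 !squarefree_gt0.
apply/eqP; apply: contraT => k1.
have k0 : (0 < k)%N by case: k kmn {k1} => //; rewrite dvd0n; lia.
have pp : prime (pdiv k) by apply: pdiv_prime; lia.
set p := pdiv k in pp.
have p2 : (p ^ 2 %| m * n)%N by apply: dvdn_trans kmn; rewrite dvdn_exp2r ?pdiv_dvd.
have p1 : p <> 1%N by move=> p1; rewrite p1 in pp.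
have [pm|pm] := boolP (p %| m)%N; case: p1.
  by apply: sm; rewrite -(@Gauss_dvdl _ _ n) // coprimeXl // (coprime_dvdl pm).
by apply: sn; rewrite -(@Gauss_dvdr _ m) // coprimeXl // prime_coprime.
Qed.

Lemma squarefree_prime (p : nat) : prime p -> squarefree p.
Proof.
move=> pp m mp; have mp1 : (m %| p)%N by rewrite (dvdn_trans _ mp) ?expnS ?dvdn_mulr.
have [_ /(_ m mp1) /pred2P[]//] := primeP pp => E; move: mp.
have := prime_gt1 pp; rewrite E => p1 /dvdn_leq; rewrite expnS expn1; nia.
Qed.

Lemma coprime_prodr (m : nat) (ps : seq nat) :
  coprime m (\prod_(p <- ps) p)%N = all (coprime m) ps.
Proof.
elim: ps => [|p ps IH]; first by rewrite big_nil coprimen1.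
by rewrite big_cons coprimeMr IH.
Qed.

Lemma prime_notin_coprime (p : nat) (ps : seq nat) :
  prime p -> all prime ps -> p \notin ps -> coprime p (\prod_(q <- ps) q)%N.
Proof.
move=> pp pps pN; rewrite coprime_prodr; apply/allP => q qps.
rewrite prime_coprime // dvdn_prime2 // ?(allP pps) //.
by apply: contraNneq pN => ->.
Qed.

Lemma squarefree_prod (ps : seq nat) :
  uniq ps -> all prime ps -> squarefree (\prod_(p <- ps) p)%N.
Proof.
elim: ps => [|p ps IH] /=; first by rewrite big_nil => _ _; exact: squarefree1.
move=> /andP[pN ups] /andP[pp pps]; rewrite big_cons.
by apply: squarefreeM; rewrite ?prime_notin_coprime //; [exact: squarefree_prime | exact: IH].
Qed.

Lemma multiplicative_prod (R : realType) (f : nat -> R) (ps : seq nat) :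
  multiplicative_fun f -> uniq ps -> all prime ps ->
  f (\prod_(p <- ps) p)%N = \prod_(p <- ps) f p.
Proof.
move=> [f1 fM]; elim: ps => [|p ps IH] /=; first by rewrite !big_nil.
move=> /andP[pN ups] /andP[pp pps]; rewrite !big_cons fM ?IH //.
- exact: prime_gt0.
- exact/squarefree_gt0/squarefree_prod.
- exact: prime_notin_coprime.
Qed.

Lemma perm_divisors_primeM (p n : nat) : prime p -> coprime p n -> (0 < n)%N ->
  perm_eq (divisors (p * n)) (divisors n ++ [seq (p * d)%N | d <- divisors n]).
Proof.
move=> pp cpn n0; have p0 := prime_gt0 pp.
apply: uniq_perm; rewrite ?divisors_uniq //.
  rewrite cat_uniq divisors_uniq map_inj_uniq ?divisors_uniq ?andbT //=; last first.
    by move=> x y /eqP; rewrite eqn_pmul2l // => /eqP.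
  apply/hasPn => _ /mapP[d _ ->]; rewrite -dvdn_divisors //.
  apply: contraL cpn => /(dvdn_trans (dvdn_mulr d (dvdnn p))) pn.
  by rewrite prime_coprime // pn.
move=> d; rewrite mem_cat -!dvdn_divisors ?muln_gt0 ?p0 //.
apply/idP/orP => [dpn|[dn|/mapP[e en ->]]]; last first.
- by rewrite dvdn_pmul2l // dvdn_divisors.
- exact: dvdn_mull.
have [/dvdnP[e de]|pd] := boolP (p %| d)%N.
  right; apply/mapP; exists e; last by rewrite mulnC.
  by rewrite -dvdn_divisors // -(@dvdn_pmul2l p) // mulnC -de.
by left; rewrite -(@Gauss_dvdr _ p) // coprime_sym prime_coprime.
Qed.

(** Expanding the product gives one term per divisor. It serves twice: with 1/d for the proportion
    left over, and with mu(d)/d for the cost of a block. *)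
Lemma sum_divisors_prod (R : realType) (f : nat -> R) (ps : seq nat) :
  multiplicative_fun f -> uniq ps -> all prime ps ->
  \sum_(d <- divisors (\prod_(p <- ps) p)%N) f d = \prod_(p <- ps) (1 + f p).
Proof.
move=> [f1 fM]; elim: ps => [|p ps IH] /=.
  by rewrite !big_nil big_cons big_nil addr0.
move=> /andP[pN ups] /andP[pp pps]; rewrite !big_cons.
have n0 := squarefree_gt0 _ (squarefree_prod _ ups pps).
have cpn := prime_notin_coprime _ _ pp pps pN.
rewrite (perm_big _ (perm_divisors_primeM _ _ pp cpn n0)) big_cat big_map /=.
rewrite mulrDl mul1r IH //; congr (_ + _).
rewrite -IH // mulr_sumr big_seq [RHS]big_seq; apply: eq_bigr => d.
rewrite -dvdn_divisors // => dn; rewrite fM ?(prime_gt0 pp) //.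
- exact: dvdn_gt0 dn.
- exact: coprime_dvdr dn cpn.
Qed.

(** * Finite families of residue classes and greedy covering *)

(* The pair (a, d) stands for the residue class of a modulo d. *)
Definition covers (L : seq (nat * nat)) (x : nat) : bool :=
  has (fun c => x == c.1 %[mod c.2])%N L.

Definition cost (R : realType) (mu : nat -> R) (L : seq (nat * nat)) : R :=
  \sum_(c <- L) mu c.2 / c.2%:R.

Lemma sum_count_modn (d : nat) (S : seq nat) : (0 < d)%N ->
  (\sum_(c < d) count (fun x => x == c %[mod d]) S = size S)%N.
Proof.
move=> d0; elim: S => [|x S IH] /=; first by rewrite big1.
rewrite big_split /= IH (bigD1 (Ordinal (ltn_pmod x d0))) //= modn_mod eqxx.
rewrite big1 // => c cx; rewrite (modn_small (ltn_ord c)).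
by case: eqP => // xc; case/eqP: cx; apply/val_inj.
Qed.

(** Pigeonhole: the fullest of the [d] classes holds at least the average share of [S]. *)
Lemma popular_residue (d : nat) (S : seq nat) : (0 < d)%N ->
  exists c, (size S <= d * count (fun x => x == c %[mod d]) S)%N.
Proof.
move=> d0; rewrite -(sum_count_modn d S d0).
pose F (c : 'I_d) := count (fun x => x == c %[mod d])%N S.
exists (nat_of_ord [arg max_(c > Ordinal d0) F c]%N).
case: arg_maxnP => // c _ Hc; rewrite -[X in (X * _)%N]card_ord -sum_nat_const.
by apply: leq_sum => i _; apply: Hc.
Qed.

(** Each modulus in turn takes the most popular residue among the elements still uncovered, which
    removes at least a proportion 1/d of them. *)
Lemma greedy_cover (R : realType) (S ds : seq nat) : all (ltn 0) ds ->
  exists G : seq (nat * nat), map snd G = ds /\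
    (count (fun x => ~~ covers G x) S)%:R
      <= (size S)%:R * \prod_(d <- ds) (1 - d%:R^-1) :> R.
Proof.
elim: ds S => [|d ds IH] S /=.
  by move=> _; exists [::]; rewrite big_nil mulr1 ler_nat count_size.
move=> /andP[d0 ds0]; have [c Hc] := popular_residue d S d0.
pose P x := (x == c %[mod d])%N.
have [G [Gds HG]] := IH ([seq x <- S | ~~ P x]) ds0.
exists ((c, d) :: G); split; first by rewrite /= Gds.
rewrite big_cons mulrA.
have -> : count (fun x => ~~ covers ((c, d) :: G) x) S
    = count (predC (covers G)) ([seq x <- S | ~~ P x]).
  by rewrite count_filter; apply: eq_count => x /=; rewrite negb_or andbC.
apply: le_trans HG _; apply: ler_wpM2r.
  rewrite big_seq; apply: prodr_ge0 => e eds; rewrite subr_ge0 invf_le1 ?ler1n ?ltr0n.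
    exact: (allP ds0).
  exact: (allP ds0).
rewrite size_filter; have := count_predC P S; move: Hc; rewrite -/P.
set u := count P S; set v := count (predC P) S => Hc uv.
rewrite mulrBr mulr1 lerBrDr -uv natrD addrC lerD2r ler_pdivrMr ?ltr0n //.
by rewrite -natrD -natrM ler_nat uv mulnC.
Qed.

(** * Weights mu(d)/d and the block of large primes *)

Lemma mu_ge1 (R : realType) (lambda : R) (mu : nat -> R) (n : nat) :
  0 < lambda -> multiplicative_fun mu ->
  (forall p i : nat, prime p -> (1 <= i)%N -> mu (p ^ i)%N = 1 + lambda / p%:R) ->
  (0 < n)%N -> 1 <= mu n.
Proof.
move=> l0 [mu1 muM] mup; elim/ltn_ind: n => n IH n0.
have [n1|n1] := leqP n 1; first by rewrite (_ : n = 1%N) ?mu1 //; lia.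
have pp := pdiv_prime n1; set p := pdiv n in pp.
have pn : (0 < logn p n)%N by rewrite logn_gt0 mem_primes pp n0 pdiv_dvd.
(* [n] splits into its full power of [p] and a smaller part prime to [p], to which induction
   applies. *)
rewrite -(partnC p n0) p_part muM ?part_gt0 ?expn_gt0 ?prime_gt0 //; last first.
  by rewrite -p_part coprime_partC.
rewrite mup // mulr_ege1 //.
  by rewrite lerDl mulr_ge0 ?invr_ge0 // ltW.
apply: IH; last exact: part_gt0.
have := partnC p n0; have p1 : (1 < n`_p)%N.
  by rewrite p_part -{1}(exp1n (logn p n)) ltn_exp2r // prime_gt1.
have := part_gt0 p^' n; nia.
Qed.

Lemma multiplicative_div (R : realType) (mu : nat -> R) :
  multiplicative_fun mu -> multiplicative_fun (fun d => mu d / d%:R).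
Proof.
move=> [mu1 muM]; split=> [|m n m0 n0 cmn]; first by rewrite mu1 divr1.
by rewrite muM // natrM invfM mulrACA.
Qed.

(** By 1 - x <= exp(-x), the product is at most the exponential of minus the sum of 1/d over the
    divisors d > 1, and that sum is the product of the 1 + 1/p, minus 1. *)
Lemma prod_inv_divisors_le (R : realType) (Q : nat) (ps : seq nat) :
  uniq ps -> all prime ps -> Q = (\prod_(p <- ps) p)%N ->
  \prod_(d <- divisors Q | d != 1%N) (1 - d%:R^-1)
    <= expR (1 - \prod_(p <- ps) (1 + p%:R^-1)) :> R.
Proof.
move=> ups pps QE; have Q0 : (0 < Q)%N by rewrite QE; exact/squarefree_gt0/squarefree_prod.
have mf : multiplicative_fun (fun d => d%:R^-1 : R).
  by split=> [|m n _ _ _]; rewrite ?invr1 // natrM invfM.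
rewrite -(sum_divisors_prod R _ _ mf ups pps) -QE.
rewrite (bigD1_seq 1%N) ?divisors_uniq -?dvdn_divisors //= invr1 opprD addNKr.
rewrite -sumrN expR_sum big_seq_cond [leRHS]big_seq_cond; apply: ler_prod => d /andP[].
rewrite -dvdn_divisors // => dQ _.
have d0 : (0 < d)%N := dvdn_gt0 Q0 dQ.
by rewrite subr_ge0 invf_le1 ?ltr0n // ler1n d0 /= expR_ge1Dx.
Qed.

Lemma block_of_large_primes (R : realType) (lambda : R) : 0 < lambda ->
  exists A : R, 0 < A /\ forall mu : nat -> R, multiplicative_fun mu ->
    (forall p i : nat, prime p -> (1 <= i)%N -> mu (p ^ i)%N = 1 + lambda / p%:R) ->
  forall B : nat, exists (Q : nat) (G : seq (nat * nat)) (U : seq nat),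
    [/\ squarefree Q, forall p, prime p -> (p %| Q)%N -> (B < p)%N, uniq (map snd G)
      & forall c, c \in G -> (c.2 %| Q)%N /\ (1 < c.2)%N] /\
    [/\ forall x, covers G x || (x %% Q \in U)%N, cost R mu G <= A
      & (size U)%:R * (mu Q / Q%:R) <= 2^-1].
Proof.
move=> l0; pose L := Num.bound lambda.
have lL : lambda <= L%:R by apply/ltW/archi_boundP/ltW.
have [K [K1 HK]] := expR_beats_power R L.
exists ((2 * K) ^+ 2); split; first by apply: exprn_gt0; lra.
move=> mu muM mup B.
(* Primes above [L] satisfy lambda/p <= 1, which the cost bound needs. *)
have [ps [ups pps Bps KS SK]] := prime_prod_window R (maxn B L) K K1.
set S := \prod_(p <- ps) _ in KS SK.
pose Q := (\prod_(p <- ps) p)%N.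
have sQ : squarefree Q by exact: squarefree_prod.
have Q0 := squarefree_gt0 _ sQ.
pose ds := [seq d <- divisors Q | d != 1%N].
have dsP d : d \in ds -> (d %| Q)%N /\ (1 < d)%N.
  rewrite mem_filter -dvdn_divisors // => /andP[d1 dQ]; split=> //.
  have := dvdn_gt0 Q0 dQ; lia.
have ds0 : all (ltn 0) ds by apply/allP => d /dsP[_ /ltnW].
have [G [Gds HG]] := greedy_cover R (iota 0 Q) ds ds0.
exists Q, G, [seq x <- iota 0 Q | ~~ covers G x]; split; split=> //.
- move=> p pp pQ; have /(allP Bps) : p \in ps; last by rewrite gtn_max => /andP[].
  apply: contraLR pQ => pN; rewrite -prime_coprime //; exact: prime_notin_coprime.
- by rewrite Gds filter_uniq ?divisors_uniq.
- by move=> c cG; apply: dsP; rewrite -Gds map_f.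
- move=> x; rewrite mem_filter mem_iota /= add0n ltn_mod Q0 andbT.
  (* All moduli in [G] divide [Q], so being covered depends only on the residue modulo [Q]. *)
  have -> : covers G (x %% Q) = covers G x; last by case: (covers G x).
  apply: eq_in_has => c cG; rewrite modn_dvdm //.
  by have /dsP[] : c.2 \in ds by rewrite -Gds map_f.
- rewrite /cost -(big_map snd xpredT (fun d => mu d / d%:R)) Gds big_filter.
  have mu0 d : (d \in divisors Q) -> 0 <= mu d / d%:R.
    rewrite -dvdn_divisors // => /(dvdn_gt0 Q0) d0; rewrite mulr_ge0 ?invr_ge0 //.
    exact: le_trans (mu_ge1 _ _ _ d l0 muM mup d0).
  apply: (@le_trans _ _ (\sum_(d <- divisors Q) mu d / d%:R)).
    rewrite big_mkcond big_seq [leRHS]big_seq; apply: ler_sum => d dQ.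
    by case: ifP => // _; apply: mu0.
  rewrite (sum_divisors_prod R _ _ (multiplicative_div _ _ muM) ups pps).
  (* Factor by factor, 1 + (1 + lambda/p)/p <= 1 + 2/p <= (1 + 1/p)^2. *)
  apply: (@le_trans _ _ (S ^+ 2)); last first.
    rewrite lerXn2r ?nnegrE //; lra.
  rewrite -prodrXl big_seq [leRHS]big_seq; apply: ler_prod => p pps'.
  have pp := allP pps p pps'.
  have := mup p 1%N pp (leqnn 1); rewrite expn1 => ->.
  have p0 : 0 < p%:R :> R by rewrite ltr0n prime_gt0.
  have Lp : lambda <= p%:R.
    by rewrite (le_trans lL) // ler_nat; move: (allP Bps p pps'); lia.
  have : lambda / p%:R <= 1 by rewrite ler_pdivrMr // mul1r.
  have : 0 < lambda / p%:R by rewrite divr_gt0.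
  have : 0 < p%:R^-1 :> R by rewrite invr_gt0.
  set x := p%:R^-1; set y := lambda / _; nra.
have muQ : mu Q <= (2 * K) ^+ L.
  rewrite multiplicative_prod //.
  apply: (@le_trans _ _ (S ^+ L)); last by rewrite lerXn2r ?nnegrE //; lra.
  rewrite -prodrXl big_seq [leRHS]big_seq; apply: ler_prod => p pps'.
  have pp := allP pps p pps'.
  have := mup p 1%N pp (leqnn 1); rewrite expn1 => ->.
  have p0 : 0 < p%:R :> R by rewrite ltr0n prime_gt0.
  apply/andP; split; first by rewrite addr_ge0 // ltW // divr_gt0.
  apply: (@le_trans _ _ (1 + L%:R / p%:R)).
    by rewrite lerD2l ler_pM2r ?invr_gt0.
  have x0 : 0 <= p%:R^-1 :> R by rewrite invr_ge0 ltW.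
  (* Bernoulli's inequality 1 + L/p <= (1 + 1/p)^L, by induction on the exponent. *)
  elim: (L) => [|k IH]; first by rewrite mul0r addr0 expr0.
  rewrite exprSr -natr1; move: IH x0.
  have : 0 <= k%:R :> R by [].
  set x := p%:R^-1; set y := (1 + x) ^+ k; nra.
have QR : Q%:R != 0 :> R by rewrite pnatr_eq0 -lt0n.
have mQ1 : 1 <= mu Q := mu_ge1 _ _ _ Q l0 muM mup Q0.
apply: le_trans HK; rewrite size_filter.
apply: (@le_trans _ _ (Q%:R * expR (1 - S) * (mu Q / Q%:R))).
  apply: ler_wpM2r; first by rewrite mulr_ge0 ?invr_ge0 //; lra.
  apply: le_trans HG _; rewrite size_iota ler_wpM2l // big_filter.
  exact: (prod_inv_divisors_le R Q ps).
have -> : Q%:R * expR (1 - S) * (mu Q / Q%:R) = expR (1 - S) * mu Q by field.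
apply: ler_pM; rewrite ?expR_ge0 //; first lra.
by rewrite ler_expR; lra.
Qed.

(** * Reducing the total weight of the remaining classes *)

(* The bound [B < c.2] keeps the moduli of successive reductions distinct. *)
Definition reduces (R : realType) (mu : nat -> R) (A r : R) (B : nat)
    (T L T' : seq (nat * nat)) : Prop :=
  [/\ forall x, covers T x -> covers L x || covers T' x,
      uniq (map snd L),
      forall c, c \in L -> squarefree c.2 /\ (B < c.2)%N
    & forall c, c \in T' -> squarefree c.2] /\
  cost R mu L <= A * cost R mu T /\ cost R mu T' <= r * cost R mu T.

(** The block is transplanted into the class of [b] modulo [q] by the Chinese remainder theorem. By
    multiplicativity all its weights are scaled by mu(q)/q. *)
Lemma reduce_class (R : realType) (lambda : R) : 0 < lambda ->
  exists A : R, 0 < A /\ forall mu : nat -> R, multiplicative_fun mu ->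
    (forall p i : nat, prime p -> (1 <= i)%N -> mu (p ^ i)%N = 1 + lambda / p%:R) ->
  forall (B b q : nat), squarefree q ->
    exists L T', reduces R mu A 2^-1 B [:: (b, q)] L T'.
Proof.
move=> l0; have [A [A0 HA]] := block_of_large_primes R lambda l0.
exists A; split=> // mu muM mup B b q sq.
have q0 := squarefree_gt0 _ sq.
(* Primes above [q] make [Q] coprime to [q]; primes above [B] make every new modulus exceed [B]. *)
have [Q [G [U [[sQ BQ uG GQ] [cG wG wU]]]]] := HA mu muM mup (maxn B q).
have Q0 := squarefree_gt0 _ sQ.
have cqQ : coprime q Q.
  rewrite coprime_sym; apply: contraT => /eqP g1.
  have g0 : (0 < gcdn Q q)%N by rewrite gcdn_gt0 q0 orbT.
  have pp : prime (pdiv (gcdn Q q)).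
    by apply: pdiv_prime; rewrite ltn_neqAle eq_sym g0 andbT; apply/eqP.
  have /dvdn_leq pq : (pdiv (gcdn Q q) %| q)%N by rewrite (dvdn_trans (pdiv_dvd _)) ?dvdn_gcdr.
  have := BQ _ pp (dvdn_trans (pdiv_dvd _) (dvdn_gcdl _ _)); move: (pq q0); lia.
have cqd c : c \in G -> coprime q c.2 by move=> /GQ[cQ _]; exact: coprime_dvdr cQ cqQ.
have w0 : 0 <= mu q / q%:R.
  by rewrite mulr_ge0 ?invr_ge0 // (le_trans _ (mu_ge1 _ _ _ q l0 muM mup q0)).
have [_ mM] := multiplicative_div _ _ muM.
exists [seq (chinese q c.2 b c.1, q * c.2)%N | c <- G].
exists [seq (chinese q Q b u, q * Q)%N | u <- U].
split; split.
- move=> x; rewrite {1}/covers /= orbF => xb.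
  have /orP[/hasP[c cG' xc]|xU] := cG x; apply/orP; [left|right]; apply/hasP.
    exists (chinese q c.2 b c.1, q * c.2)%N; first exact: (map_f (fun c => (_, _))).
    have cc := cqd c cG'.
    by rewrite /= chinese_remainder // chinese_modl // chinese_modr // (eqP xb) (eqP xc) !eqxx.
  exists (chinese q Q b (x %% Q), q * Q)%N; first exact: (map_f (fun u => (_, _))).
  by rewrite /= chinese_remainder // chinese_modl // chinese_modr // (eqP xb) modn_mod !eqxx.
- rewrite -map_comp (map_comp (muln q) snd) map_inj_uniq // => x y /eqP.
  by rewrite eqn_pmul2l // => /eqP.
- move=> _ /mapP[c cG' ->] /=; have [cQ c1] := GQ c cG'; split.
    exact: squarefreeM (cqd c cG') sq (squarefree_dvd _ _ cQ sQ).
  have := BQ _ (pdiv_prime c1) (dvdn_trans (pdiv_dvd _) cQ).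
  rewrite gtn_max => /andP[/leq_trans Bp _]; apply: Bp.
  by rewrite (leq_trans (pdiv_leq (ltnW c1))) // leq_pmull.
- by move=> _ /mapP[u _ ->] /=; exact: squarefreeM.
- rewrite /cost big_map big_seq1 /=.
  rewrite (eq_big_seq (fun c => mu q / q%:R * (mu c.2 / c.2%:R))) => [|c cG']; last first.
    rewrite mM //; last exact: cqd.
    by have [_ /ltnW] := GQ c cG'.
  by rewrite -mulr_sumr mulrC ler_wpM2r.
- rewrite /cost big_map big_seq1 /= big_const_seq count_predT iter_addr_0.
  rewrite mM // -[leLHS]mulr_natl mulrCA [leRHS]mulrC.
  by rewrite ler_wpM2l.
Qed.

Lemma uniq_moduli_cat (B : nat) (L1 L2 : seq (nat * nat)) :
  uniq (map snd L1) -> uniq (map snd L2) ->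
  (forall c, c \in L1 -> c.2 <= B)%N -> (forall c, c \in L2 -> B < c.2)%N ->
  uniq (map snd (L1 ++ L2)).
Proof.
move=> u1 u2 H1 H2; rewrite map_cat cat_uniq u1 u2 andbT /=.
apply/hasPn => _ /mapP[c2 /H2 c2B ->]; apply/negP => /mapP[c1 /H1 c1B E].
by move: c2B; rewrite E ltnNge c1B.
Qed.

Lemma moduli_bound (B : nat) (L : seq (nat * nat)) :
  exists B', (B <= B')%N /\ forall c, c \in L -> (c.2 <= B')%N.
Proof.
exists (B + \max_(c <- L) c.2)%N; split=> [|c cL]; first exact: leq_addr.
by rewrite (big_rem c cL) /=; apply: leq_trans (leq_maxl _ _) (leq_addl _ _).
Qed.

Lemma covers_cat (L1 L2 : seq (nat * nat)) (x : nat) :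
  covers (L1 ++ L2) x = covers L1 x || covers L2 x.
Proof. exact: has_cat. Qed.

Lemma cost_cat (R : realType) (mu : nat -> R) (L1 L2 : seq (nat * nat)) :
  cost R mu (L1 ++ L2) = cost R mu L1 + cost R mu L2.
Proof. exact: big_cat. Qed.

(** Classes in [T] may share a modulus, so each is reduced using moduli beyond all those already
    used. Costs add up, so the constants [A] and 1/2 are preserved. *)
Lemma reduce_classes (R : realType) (lambda : R) : 0 < lambda ->
  exists A : R, 0 < A /\ forall mu : nat -> R, multiplicative_fun mu ->
    (forall p i : nat, prime p -> (1 <= i)%N -> mu (p ^ i)%N = 1 + lambda / p%:R) ->
  forall (T : seq (nat * nat)) (B : nat), (forall c, c \in T -> squarefree c.2) ->
    exists L T', reduces R mu A 2^-1 B T L T'.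
Proof.
move=> l0; have [A [A0 HA]] := reduce_class R lambda l0.
exists A; split=> // mu muM mup; elim=> [|[b q] T IH] B sT.
  by exists [::], [::]; do 2! split=> //; rewrite /cost !big_nil mulr0.
have sq : squarefree q by apply: (sT (b, q)); rewrite mem_head.
have [L1 [T1 [[c1 u1 s1 t1] [w1 v1]]]] := HA mu muM mup B b q sq.
have [B' [BB' L1B']] := moduli_bound B L1.
have [c cT|L2 [T2 [[c2 u2 s2 t2] [w2 v2]]]] := IH B'.
  by apply: sT; rewrite inE cT orbT.
exists (L1 ++ L2), (T1 ++ T2); split; split.
- move=> x; rewrite -cat1s !covers_cat => /orP[/c1|/c2] /orP[->|->]; by rewrite ?orbT.
- by apply: (uniq_moduli_cat B') => // c /s2[].
- move=> c; rewrite mem_cat => /orP[/s1//|/s2[sc Bc]]; split=> //.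
  exact: leq_ltn_trans Bc.
- by move=> c; rewrite mem_cat => /orP[/t1|/t2].
- by rewrite -cat1s !cost_cat mulrDr lerD.
- by rewrite -cat1s !cost_cat mulrDr lerD.
Qed.

Lemma reduce_iter (R : realType) (lambda : R) : 0 < lambda ->
  exists A : R, 0 < A /\ forall mu : nat -> R, multiplicative_fun mu ->
    (forall p i : nat, prime p -> (1 <= i)%N -> mu (p ^ i)%N = 1 + lambda / p%:R) ->
  forall (j : nat) (T : seq (nat * nat)) (B : nat),
    (forall c, c \in T -> squarefree c.2) ->
    exists L T', reduces R mu A (2^-1 ^+ j) B T L T'.
Proof.
move=> l0; have [A [A0 HA]] := reduce_classes R lambda l0.
(* The sum of the geometric series A + A/2 + A/4 + ...; in the induction, a total weight w costs at
   most A w + 2A (w/2) = 2A w. *)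
exists (2 * A); split=> [|mu muM mup]; first lra.
elim=> [|j IH] T B sT.
  exists [::], T; split; split=> //.
    rewrite /cost big_nil mulr_ge0 //; first lra.
    rewrite big_seq; apply: sumr_ge0 => c cT; rewrite mulr_ge0 ?invr_ge0 //.
    exact: le_trans (mu_ge1 _ _ _ c.2 l0 muM mup (squarefree_gt0 _ (sT c cT))).
  by rewrite expr0 mul1r.
have [L1 [T1 [[c1 u1 s1 t1] [w1 v1]]]] := HA mu muM mup T B sT.
have [B' [BB' L1B']] := moduli_bound B L1.
have [L2 [T2 [[c2 u2 s2 t2] [w2 v2]]]] := IH T1 B' t1.
exists (L1 ++ L2), T2; split; split=> //.
- by move=> x /c1; rewrite covers_cat => /orP[->//|/c2 /orP[->|->]]; rewrite ?orbT.
- by apply: (uniq_moduli_cat B') => // c /s2[].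
- move=> c; rewrite mem_cat => /orP[/s1//|/s2[sc Bc]]; split=> //.
  exact: leq_ltn_trans Bc.
- rewrite cost_cat; nra.
- apply: le_trans v2 _; rewrite exprSr -mulrA ler_wpM2l // exprn_ge0 // invr_ge0 //.
Qed.

(** * Density of a set covered by residue classes *)

Lemma sum_residue_class (b q m : nat) : (0 < q)%N ->
  (\sum_(0 <= x < m * q) (x == b %[mod q]) = m)%N.
Proof.
move=> q0; rewrite big_nat_mul -[RHS](subn0 m) -[RHS]mul1n -[RHS]mulnC -sum_nat_const_nat.
apply: eq_bigr => i _; rewrite mulSn addnC -{1}[(i * q)%N]add0n big_addn addKn.
have md x : (x + i * q = x %[mod q])%N by rewrite -modnDmr modnMl addn0.
rewrite big_mkord (bigD1 (Ordinal (ltn_pmod b q0))) //= md modn_mod eqxx.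
rewrite big1 // => c cb; rewrite md (modn_small (ltn_ord c)).
by case: eqP => // E; case/eqP: cb; apply/val_inj.
Qed.

(** A union bound. The moduli in [T] need not divide [N], so points are counted below [m * N]: each
    residue counted in the density has [m] representatives there, and each class of [T] has exactly
    m N / c.2 elements. *)
Lemma density_le_sum_inv (R : realType) (N : nat) (S : set int)
    (T : seq (nat * nat)) : (0 < N)%N ->
  (forall c, c \in T -> 0 < c.2)%N ->
  (forall x : nat, S x%:Z -> covers T x) ->
  density R N S <= \sum_(c <- T) c.2%:R^-1.
Proof.
move=> N0 T0 ST; pose m := (\prod_(c <- T) c.2)%N.
have m0 : (0 < m)%N by rewrite /m big_seq; apply: prodn_cond_gt0 => c; apply: T0.
rewrite /density; set E := [set r : 'I_N | _]%SET.
have H1 : (m * #|E| <= \sum_(0 <= x < m * N) covers T x)%N.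
  rewrite big_nat_mul -{1}(subn0 m) -sum_nat_const_nat; apply: leq_sum => i _.
  rewrite mulSn addnC -{1}[(i * N)%N]add0n big_addn addKn big_mkord -sum1_card big_mkcond.
  apply: leq_sum => r _; case: ifP => //; rewrite inE => /asboolP rS.
  rewrite ST //; apply: rS; exists i%:Z; rewrite PoszD PoszM; ring.
have H2 : (\sum_(0 <= x < m * N) covers T x)%:R <= \sum_(c <- T) (m * N)%:R / c.2%:R :> R.
  apply: (@le_trans _ _ (\sum_(c <- T) \sum_(0 <= x < m * N) (x == c.1 %[mod c.2])%N)%:R).
    rewrite ler_nat exchange_big /=; apply: leq_sum => x _.
    elim: (T) => [|c s IH]; first by rewrite big_nil.
    by rewrite big_cons /=; move: IH; do 2! case: (_ == _) || case: (covers _ _); lia.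
  rewrite natr_sum big_seq [leRHS]big_seq; apply: ler_sum => c cT.
  have c0 := T0 c cT.
  have cm : (c.2 %| m * N)%N.
    by rewrite dvdn_mulr // /m (big_rem c) //= dvdn_mulr.
  by rewrite -{1}(divnK cm) sum_residue_class // -{2}(divnK cm) natrM mulfK // pnatr_eq0 -lt0n.
rewrite ler_pdivrMr ?ltr0n // -(@ler_pM2l _ m%:R) ?ltr0n // -natrM.
apply: (@le_trans _ _ (\sum_(0 <= x < m * N) covers T x)%:R); first by rewrite ler_nat.
by apply: le_trans H2 _; rewrite -mulr_sumr natrM -mulrA [N%:R * _]mulrC.
Qed.

(** * Iteration from the trivial class and passage to the density *)

Theorem theorem10p2 (R : realType) (lambda : R) (hlambda : 0 < lambda) :
  exists C : R, 0 < C /\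
    forall mu : nat -> R,
      multiplicative_fun mu ->
      (forall p i : nat, prime p -> (1 <= i)%N ->
         mu (p ^ i)%N = 1 + lambda / p%:R) ->
    forall M eps : R, 0 < M -> 0 < eps ->
      exists (k : nat) (a : 'I_k -> int) (d : 'I_k -> nat),
        [/\ injective d,
            forall i : 'I_k, squarefree (d i),
            forall i : 'I_k, M <= (d i)%:R,
            \sum_(i < k) mu (d i) / (d i)%:R <= C
          & density R (lcm_moduli d) (uncovered a d) <= eps].
Proof.
have [A [A0 HA]] := reduce_iter R lambda hlambda.
exists A; split=> // mu muM mup M eps M0 eps0.
have [j Hj] : exists j : nat, 2^-1 ^+ j <= eps.
  exists (Num.bound eps^-1).
  rewrite exprVn invf_ple ?posrE ?exprn_gt0 //; apply/ltW.
  apply: lt_trans (archi_boundP _) _; first by rewrite invr_ge0 ltW.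
  by rewrite -natrX ltr_nat ltn_expl.
(* The start is all of Z as the class of 0 modulo 1, of weight 1; the bound [Num.bound M] forces all
   moduli above [M]. *)
have [c|L [T [[cov uL sL sT] [wL wT]]]] := HA mu muM mup j [:: (0%N, 1%N)] (Num.bound M).
  by rewrite inE => /eqP ->; exact: squarefree1.
have w1 : cost R mu [:: (0%N, 1%N)] = 1 by rewrite /cost big_seq1 muM.1 divr1.
rewrite w1 !mulr1 in wL wT.
pose c0 := (0%N, 1%N).
exists (size L), (fun i => (nth c0 L i).1%:Z), (fun i => (nth c0 L i).2).
have Li (i : 'I_(size L)) : nth c0 L i \in L by rewrite mem_nth.
split.
- move=> i1 i2 /= E; apply/val_inj.
  have := uniqP 1%N uL i1 i2; rewrite !inE size_map !ltn_ord => H.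
  by apply: H => //; rewrite !(nth_map c0).
- by move=> i; have [] := sL _ (Li i).
- move=> i; have [_ Mi] := sL _ (Li i).
  apply/ltW/(lt_trans (archi_boundP (ltW M0))); by rewrite ltr_nat.
- rewrite -(big_mkord xpredT (fun i => mu (nth c0 L i).2 / (nth c0 L i).2%:R)).
  by rewrite -(big_nth c0 xpredT (fun c => mu c.2 / c.2%:R)).
set N := lcm_moduli _; set S := uncovered _ _.
have N0 : (0 < N)%N.
  rewrite /N /lcm_moduli; elim/big_ind: _ => // [x y x0 y0|i _].
    by rewrite lcmn_gt0 x0.
  by apply: squarefree_gt0; have [] := sL _ (Li i).
apply: le_trans Hj; apply: le_trans wT.
(* Since mu >= 1, the sum of 1/d over the remaining classes is at most their cost. *)
apply: (@le_trans _ _ (\sum_(c <- T) c.2%:R^-1)).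
  apply: density_le_sum_inv => // [c /sT/squarefree_gt0 //|x Sx].
  have /orP[/hasP[c cL xc]|//] : covers L x || covers T x.
    by apply: cov; rewrite /covers /= !modn1.
  case: Sx; have ci : (index c L < size L)%N by rewrite index_mem.
  exists (Ordinal ci) => //=; rewrite nth_index //.
  (* [x] and [c.1] have the same remainder modulo [c.2], so they differ by [c.2] times the
     difference of their quotients. *)
  exists ((x %/ c.2)%N%:Z - (c.1 %/ c.2)%N%:Z).
  rewrite {1}(divn_eq x c.2) {1}(divn_eq c.1 c.2) -(eqP xc) !PoszD !PoszM; ring.
rewrite /cost big_seq [leRHS]big_seq; apply: ler_sum => c /sT/squarefree_gt0 c20.
rewrite -[leLHS]mul1r ler_wpM2r ?invr_ge0 //.
exact: mu_ge1 hlambda muM mup c20.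
Qed.
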